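(* Let $\Gamma$ be a closed subgroup of $\mathbf{O}(n)$, acting linearly on the real vector space $V$ of dimension $n$ via the representation $\rho$ and on the finite-dimensional real vector space $W$ via a representation $\nu$. Let $\eta:\Gamma\to\mathbf{Z}_2=\{\pm1\}$ be a nontrivial homomorphism with $\ker\eta=\Gamma_+$. Let $\{u_1,\dots,u_s\}$ be a Hilbert basis of the ring $\mathcal{P}(\Gamma_+)$ and let $\{H_0,\dots,H_r\}$ be a generating set of $\overrightarrow{\mathcal{P}}(\Gamma_+)$ as a $\mathcal{P}(\Gamma_+)$-module. Fix an arbitrary $\delta\in\Gamma\setminus\Gamma_+$, and let $S$ and $\overrightarrow{S}$ be the corresponding $\eta$-Reynolds operators on $\mathcal{P}(\Gamma_+)$ and $\overrightarrow{\mathcal{P}}(\Gamma_+)$. Put $\tilde u_0:=1$ and $\tilde u_i:=S(u_i)$ for $1\le i\le s$; and, for $0\le i\le s$ and $0\le j\le r$, put $H_{ij}:=\tilde u_iH_j$ and $\tilde H_{ij}:=\overrightarrow{S}(H_{ij})$. Then $$\{\tilde H_{ij}:\ 0\le i\le s,\ 0\le j\le r\}$$ is a generating set of $\overrightarrow{\mathcal{P}}^{\eta}(\Gamma)$ as a $\mathcal{P}(\Gamma)$-module.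
   Context: For a group $G\in\{\Gamma,\Gamma_+\}$ acting on $V$ via $\rho$ and on $W$ via $\nu$: - $\mathcal{P}(G)$ is the ring of real polynomial functions $f:V\to\mathbb{R}$ that are $G$-invariant: $f(\rho(\gamma)x)=f(x)$ for all $\gamma\in G$, $x\in V$. A Hilbert basis of $\mathcal{P}(G)$ is a finite set of $G$-invariant polynomials generating it as a ring over $\mathbb{R}$ (i.e. as an $\mathbb{R}$-algebra). - $\overrightarrow{\mathcal{P}}(G)$ is the $\mathcal{P}(G)$-module of polynomial mappings $g:V\to W$ that are $G$-equivariant: $g(\rho(\gamma)x)=\nu(\gamma)g(x)$ for all $\gamma\in G$, $x\in V$. - $\overrightarrow{\mathcal{P}}^{\eta}(\Gamma)$ is the $\mathcal{P}(\Gamma)$-module of polynomial mappings $g:V\to W$ that are $\Gamma_\eta$-equivariant: $g(\rho(\gamma)x)=\eta(\gamma)\nu(\gamma)g(x)$ for all $\gamma\in\Gamma$, $x\in V$. For the fixed $\delta\in\Gamma\setminus\Gamma_+$, the $\eta$-Reynolds operators $S:\mathcal{P}(\Gamma_+)\to\mathcal{P}(\Gamma_+)$ and $\overrightarrow{S}:\overrightarrow{\mathcal{P}}(\Gamma_+)\to\overrightarrow{\mathcal{P}}(\Gamma_+)$ are $$S(f)(x)=\tfrac12\bigl(f(x)-f(\rho(\delta)x)\bigr),\qquad \overrightarrow{S}(g)(x)=\tfrac12\bigl(g(x)-\nu(\delta)^{-1}g(\rho(\delta)x)\bigr).$$ *)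

(* Defs.v *)
From mathcomp Require Import all_boot all_order all_algebra.
From mathcomp Require Import all_classical all_reals all_analysis.
(* Not imported: the notations of mpoly clash with those of analysis. *)
From mathcomp Require mpoly.

Set Implicit Arguments.
Unset Strict Implicit.
Unset Printing Implicit Defensive.

Import Order.TTheory GRing.Theory Num.Theory.
Import numFieldNormedType.Exports.

Local Open Scope classical_set_scope.
Local Open Scope ring_scope.

Section Groups.
Context {R : realType} {n : nat}.
Implicit Type Gamma : set 'M[R]_n.

Definition orthogonal_group : set 'M[R]_n := [set A | A *m A^T = 1%:M].

(* [closed] refers to the usual topology of the space of matrices. *)
Definition closed_subgroup_of_O Gamma : Prop :=
  [/\ closed Gamma,
      Gamma `<=` orthogonal_group,
      Gamma 1%:M,
      (forall a b, Gamma a -> Gamma b -> Gamma (a *m b)) &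
      (forall a, Gamma a -> Gamma (invmx a))].

(* Maps defined on the group are total functions on matrices, of which only
   the values on [Gamma] matter. The two laws force [rho a] to be invertible
   for [a] in the group. *)
Definition representation (U : vectType R) Gamma (rho : 'M[R]_n -> 'End(U)) :
    Prop :=
  rho 1%:M = \1%VF /\
  forall a b, Gamma a -> Gamma b -> rho (a *m b) = (rho a \o rho b)%VF.

(* Homomorphisms to the multiplicative group {1, -1}, realized inside [int]. *)
Definition sign_homomorphism Gamma (eta : 'M[R]_n -> int) : Prop :=
  (forall a, Gamma a -> eta a = 1 \/ eta a = -1) /\
  (forall a b, Gamma a -> Gamma b -> eta (a *m b) = eta a * eta b).

Definition sign_kernel Gamma (eta : 'M[R]_n -> int) : set 'M[R]_n :=
  [set a | Gamma a /\ eta a = 1].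

End Groups.

Section Polynomials.
Context {R : realType}.

(* Polynomial in the coordinates of a basis; being polynomial does not depend
   on the basis. *)
Definition polynomial_function (V : vectType R) (f : V -> R) : Prop :=
  exists p : mpoly.mpoly (\dim {:V}) R,
    forall x, f x = mpoly.meval (fun i => coord (vbasis {:V}) i x) p.

Definition polynomial_mapping (V W : vectType R) (g : V -> W) : Prop :=
  forall j, polynomial_function (fun x => coord (vbasis {:W}) j (g x)).

Context {n : nat} {V W : vectType R}.
Implicit Types (G : set 'M[R]_n) (rho : 'M[R]_n -> 'End(V))
  (nu : 'M[R]_n -> 'End(W)).

Definition invariants G rho : set (V -> R) :=
  [set f | polynomial_function f /\
           forall a x, G a -> f (rho a x) = f x].

Definition equivariants G rho nu : set (V -> W) :=
  [set g | polynomial_mapping g /\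
           forall a x, G a -> g (rho a x) = nu a (g x)].

Definition eta_equivariants G rho nu (eta : 'M[R]_n -> int) : set (V -> W) :=
  [set g | polynomial_mapping g /\
           forall a x, G a -> g (rho a x) = (eta a)%:~R *: nu a (g x)].

(* The subalgebra generated by [u] consists of the polynomial expressions
   in the members of [u]. *)
Definition hilbert_basis (A : set (V -> R)) (s : nat) (u : 'I_s -> V -> R) :
    Prop :=
  (forall i, A (u i)) /\
  (forall f, A f -> exists p : mpoly.mpoly s R,
     forall x, f x = mpoly.meval (fun i => u i x) p).

Definition generates_module (A : set (V -> R)) (M : set (V -> W))
    (I : finType) (H : I -> V -> W) : Prop :=
  (forall i, M (H i)) /\
  (forall g, M g -> exists c : I -> V -> R,
     (forall i, A (c i)) /\ forall x, g x = \sum_i c i x *: H i x).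

(* The Reynolds operators are defined on all functions; they are meant to be
   applied to Gamma_+-invariants and Gamma_+-equivariants. *)
Definition reynolds rho (delta : 'M[R]_n) (f : V -> R) : V -> R :=
  fun x => 2^-1 * (f x - f (rho delta x)).

Definition vreynolds rho nu (delta : 'M[R]_n) (g : V -> W) : V -> W :=
  fun x => 2^-1 *: (g x - (nu delta)^-1%VF (g (rho delta x))).

(* Index 0 gives the constant 1, and index [lift ord0 i] gives S(u_i): the
   family u_1, ..., u_s is indexed by ['I_s]. *)
Definition utilde rho (delta : 'M[R]_n) (s : nat) (u : 'I_s -> V -> R)
    (i : 'I_s.+1) : V -> R :=
  if unlift ord0 i is Some k then reynolds rho delta (u k) else fun=> 1.

Definition Htilde rho nu (delta : 'M[R]_n) (s r : nat) (u : 'I_s -> V -> R)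
    (H : 'I_r.+1 -> V -> W) (ij : 'I_s.+1 * 'I_r.+1) : V -> W :=
  vreynolds rho nu delta
    (fun x => utilde rho delta u ij.1 x *: H ij.2 x).

End Polynomials.

(* Main.v *)
Require Import Defs.
From mathcomp Require Import all_boot all_order all_algebra.
From mathcomp Require Import all_classical all_reals all_analysis.
From mathcomp Require mpoly.
From mathcomp Require Import ring.

Set Implicit Arguments.
Unset Strict Implicit.
Unset Printing Implicit Defensive.

Import Order.TTheory GRing.Theory Num.Theory.
Import numFieldNormedType.Exports.

Local Open Scope classical_set_scope.
Local Open Scope ring_scope.

(** Write [R f = (f + f \o rho delta) / 2] and [S f = (f - f \o rho delta) / 2],
    so that [f = R f + S f]. On invariants of the index-two subgroup, [R f] is
    invariant under the whole group and [S f] changes sign with [eta], because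
    elements outside the kernel of [eta] all act like [delta].

    The scalar half of the proof is that 1 and the [S u_i] generate the
    kernel invariants as a module over the full invariants. This rests on the
    product rule [S (f g) = R f * S g + R g * S f]: the kernel invariants [f]
    whose [S f] is a combination of the [S u_i] with invariant coefficients are
    closed under sums and products and contain the constants and the [u_i],
    hence they include every polynomial in the [u_i]; then [f = R f * 1 + S f]
    ([invariants_span]).

    For the vector half, an eta-equivariant [g] is equivariant under the kernel,
    so [g = \sum_j p_j H_j], and expanding each [p_j] as above gives
    [g = \sum_(i, j) c_ij (utilde_i H_j)] with [c_ij] invariant under the whole
    group. The operator [vreynolds] fixes [g] and commutes with
    multiplication by such [c_ij] ([vreynolds_sum]), so applying it turns this
    expansion into one over the [Htilde_ij]. That the [Htilde_ij] are themselves
    eta-equivariant is the vector analogue of the sign rule for [S]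
    ([vreynolds_eta_equivariant]). *)

(** * Polynomial functions *)

(** A property of functions stable under the ring operations passes from the
    arguments of a polynomial to its values. It is used with the property of
    being polynomial, and with that of having an antisymmetric part in a given
    module. *)
Lemma meval_closed (R : realType) (T : Type) (P : (T -> R) -> Prop) (m : nat)
    (v : 'I_m -> T -> R) (p : mpoly.mpoly m R) :
  (forall c, P (fun=> c)) ->
  (forall f g, P f -> P g -> P (fun x => f x + g x)) ->
  (forall f g, P f -> P g -> P (fun x => f x * g x)) ->
  (forall i, P (v i)) ->
  P (fun x => mpoly.meval (fun i => v i x) p).
Proof.
move=> PC PD PM Pv.
have PX f k : P f -> P (fun x => f x ^+ k).
  move=> Pf; elim: k => [|k IHk]; first exact: PC.
  rewrite (_ : (fun x => _) = fun x => f x * f x ^+ k); first exact: PM.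
  by apply/funext => x; rewrite exprS.
have Pprod (I : Type) (l : seq I) (F : I -> T -> R) :
    (forall i, P (F i)) -> P (fun x => \prod_(i <- l) F i x).
  move=> PF; elim: l => [|i l IHl].
    by rewrite (_ : (fun x => _) = fun=> 1) //; apply/funext => x; rewrite big_nil.
  rewrite (_ : (fun x => _) = fun x => F i x * \prod_(k <- l) F k x).
    exact: PM.
  by apply/funext => x; rewrite big_cons.
have Psum (I : Type) (l : seq I) (F : I -> T -> R) :
    (forall i, P (F i)) -> P (fun x => \sum_(i <- l) F i x).
  move=> PF; elim: l => [|i l IHl].
    by rewrite (_ : (fun x => _) = fun=> 0) //; apply/funext => x; rewrite big_nil.
  rewrite (_ : (fun x => _) = fun x => F i x + \sum_(k <- l) F k x).
    exact: PD.
  by apply/funext => x; rewrite big_cons.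
rewrite (_ : (fun x => _) = fun x => \sum_(k <- mpoly.msupp p)
    mpoly.mcoeff k p * \prod_i v i x ^+ mpoly.fun_of_multinom k i).
  by apply: Psum => k; apply: PM => //; apply: Pprod => i; exact: PX.
by apply/funext => x; rewrite mpoly.mevalE.
Qed.

Section PolynomialFunctions.
Context {R : realType} {V W : vectType R}.

Lemma polynomial_cst (c : R) : polynomial_function (fun _ : V => c).
Proof. by exists (mpoly.mpolyC _ c) => x; rewrite mpoly.mevalC. Qed.

Lemma polynomial_coord i : polynomial_function (coord (vbasis {:V}) i).
Proof.
by exists (mpoly.mpolyX R (mpoly.mnm1 i)) => x; rewrite mpoly.mevalXU.
Qed.

Lemma polynomialD (f g : V -> R) : polynomial_function f ->
  polynomial_function g -> polynomial_function (fun x => f x + g x).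
Proof.
by move=> [p fp] [q gq]; eexists => x; rewrite fp gq -mpoly.mevalD.
Qed.

Lemma polynomialM (f g : V -> R) : polynomial_function f ->
  polynomial_function g -> polynomial_function (fun x => f x * g x).
Proof.
by move=> [p fp] [q gq]; eexists => x; rewrite fp gq -mpoly.mevalM.
Qed.

Lemma polynomialB (f g : V -> R) : polynomial_function f ->
  polynomial_function g -> polynomial_function (fun x => f x - g x).
Proof.
by move=> [p fp] [q gq]; eexists => x; rewrite fp gq -mpoly.mevalB.
Qed.

Lemma polynomial_sum m (F : 'I_m -> V -> R) :
  (forall i, polynomial_function (F i)) ->
  polynomial_function (fun x => \sum_i F i x).
Proof.
elim: m F => [|m IHm] F pF.
  rewrite (_ : (fun x => _) = fun=> 0); first exact: polynomial_cst.
  by apply/funext => x; rewrite big_ord0.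
rewrite (_ : (fun x => _) =
  fun x => F ord0 x + \sum_i F (lift ord0 i) x).
  by apply: polynomialD => //; exact: IHm.
by apply/funext => x; rewrite big_ord_recl.
Qed.

Lemma polynomial_comp (f : W -> R) (g : V -> W) : polynomial_function f ->
  polynomial_mapping g -> polynomial_function (f \o g).
Proof.
move=> [p fp] pg; rewrite (_ : f \o g =
  fun x => mpoly.meval (fun i => coord (vbasis {:W}) i (g x)) p).
  apply: meval_closed => //; [exact: polynomial_cst | exact: polynomialD |].
  exact: polynomialM.
by apply/funext => x /=; rewrite fp.
Qed.

Lemma polynomial_mapping_lfun (L : 'Hom(V, W)) : polynomial_mapping L.
Proof.
move=> j; rewrite (_ : (fun x => _) = fun x => \sum_i
    coord (vbasis {:V}) i x * coord (vbasis {:W}) j (L (vbasis {:V})`_i)).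
  apply: polynomial_sum => i; apply: polynomialM; first exact: polynomial_coord.
  exact: polynomial_cst.
apply/funext => x; rewrite {1}(coord_vbasis (memvf x)) !linear_sum.
by apply: eq_bigr => i _; rewrite !linearZ.
Qed.

End PolynomialFunctions.

Section PolynomialMappings.
Context {R : realType} {U V W : vectType R}.

Lemma polynomial_mapping_comp (g : U -> V) (h : V -> W) :
  polynomial_mapping h -> polynomial_mapping g -> polynomial_mapping (h \o g).
Proof. by move=> ph pg j; exact: polynomial_comp (ph j) pg. Qed.

Lemma polynomial_mappingZ (f : V -> R) (g : V -> W) : polynomial_function f ->
  polynomial_mapping g -> polynomial_mapping (fun x => f x *: g x).
Proof.
move=> pf pg j; rewrite (_ : (fun x => _) =
    fun x => f x * coord (vbasis {:W}) j (g x)); first exact: polynomialM.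
by apply/funext => x; rewrite linearZ.
Qed.

Lemma polynomial_mappingB (g h : V -> W) : polynomial_mapping g ->
  polynomial_mapping h -> polynomial_mapping (fun x => g x - h x).
Proof.
move=> pg ph j; rewrite (_ : (fun x => _) = fun x =>
    coord (vbasis {:W}) j (g x) - coord (vbasis {:W}) j (h x)).
  exact: polynomialB.
by apply/funext => x; rewrite linearB.
Qed.

End PolynomialMappings.

(** * The kernel of the sign and its nontrivial coset *)

Section Reynolds.
Context {R : realType} {n : nat} {Gamma : set 'M[R]_n} {V W : vectType R}.
Context {rho : 'M[R]_n -> 'End(V)} {nu : 'M[R]_n -> 'End(W)}.
Context {eta : 'M[R]_n -> int} {delta : 'M[R]_n}.
Hypothesis Gamma_subgroup : closed_subgroup_of_O Gamma.
Hypothesis rho_repr : representation Gamma rho.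
Hypothesis nu_repr : representation Gamma nu.
Hypothesis eta_sign : sign_homomorphism Gamma eta.
Let Gamma_plus := sign_kernel Gamma eta.
Hypothesis delta_notin : (Gamma `\` Gamma_plus) delta.

Let Gamma_delta : Gamma delta.
Proof. by case: delta_notin. Qed.

Let GammaM a b : Gamma a -> Gamma b -> Gamma (a *m b).
Proof. by case: Gamma_subgroup => _ _ _ + _; apply. Qed.

Let GammaV a : Gamma a -> Gamma (invmx a).
Proof. by case: Gamma_subgroup => _ _ _ _; apply. Qed.

Let Gamma_unitmx a : Gamma a -> a \in unitmx.
Proof.
by case: Gamma_subgroup => _ GO _ _ _ /GO /mulmx1_unit[].
Qed.

Let eta_delta : eta delta = -1.
Proof.
by case: (eta_sign.1 _ Gamma_delta) => // eta1; case: delta_notin => _ []; split.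
Qed.

Let rhoM a b x : Gamma a -> Gamma b -> rho (a *m b) x = rho a (rho b x).
Proof. by move=> Ga Gb; rewrite rho_repr.2// lfunE. Qed.

Let nuM a b w : Gamma a -> Gamma b -> nu (a *m b) w = nu a (nu b w).
Proof. by move=> Ga Gb; rewrite nu_repr.2// lfunE. Qed.

Let nu_delta_inj : lker (nu delta) == 0%VS.
Proof.
apply/lker0P; apply: (can_inj (g := nu (invmx delta))) => w.
rewrite -nuM ?mulVmx ?nu_repr.1 ?lfunE//; last exact: GammaV.
exact: Gamma_unitmx.
Qed.

Lemma odd_mul_delta a : Gamma a -> eta a = -1 -> Gamma_plus (delta *m a).
Proof.
by move=> Ga ea; split; [exact: GammaM | rewrite eta_sign.2// eta_delta ea].
Qed.

Lemma delta_mul_even a : Gamma_plus a ->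
  Gamma (delta *m a) /\ eta (delta *m a) = -1.
Proof.
by case=> Ga ea; split; [exact: GammaM | rewrite eta_sign.2// eta_delta ea].
Qed.

Lemma odd_coset a : Gamma a -> eta a = -1 ->
  exists2 b, Gamma_plus b & a = b *m delta.
Proof.
move=> Ga ea; exists (a *m invmx delta); last first.
  by rewrite mulmxKV//; exact: Gamma_unitmx.
split; first by apply: GammaM => //; exact: GammaV.
have := eta_sign.2 _ _ (GammaM Ga (GammaV Gamma_delta)) Gamma_delta.
rewrite mulmxKV; last exact: Gamma_unitmx.
by rewrite ea eta_delta mulrN1 => /oppr_inj.
Qed.

(** * The scalar Reynolds operators *)

Let average (f : V -> R) : V -> R := fun x => 2^-1 * (f x + f (rho delta x)).
Let S := reynolds rho delta.

Lemma average_reynolds f x : f x = average f x + S f x.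
Proof.
rewrite /average /S /reynolds -mulrDr addrACA subrr addr0 -mulr2n.
by rewrite -[f x *+ 2]mulr_natl mulKf// pnatr_eq0.
Qed.

(** Every element outside the kernel acts on kernel invariants exactly as
    [delta] does, and [delta] acts on them as an involution. *)
Lemma invariant_odd f a x : invariants Gamma_plus rho f ->
  Gamma a -> eta a = -1 -> f (rho a x) = f (rho delta x).
Proof.
move=> [_ fG] Ga /(odd_coset Ga)[b Gb ->]; have [Gb' _] := Gb.
by rewrite rhoM// fG.
Qed.

Lemma invariant_delta_odd f a x : invariants Gamma_plus rho f ->
  Gamma a -> eta a = -1 -> f (rho delta (rho a x)) = f x.
Proof.
by move=> [_ fG] Ga ea; rewrite -rhoM// fG//; exact: odd_mul_delta.
Qed.

Lemma invariant_delta_even f a x : invariants Gamma_plus rho f ->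
  Gamma_plus a -> f (rho delta (rho a x)) = f (rho delta x).
Proof.
move=> fG Ga; have [Gda eda] := delta_mul_even Ga.
by rewrite -rhoM ?(invariant_odd _ fG)//; case: Ga.
Qed.

Lemma polynomial_comp_delta (f : V -> R) : polynomial_function f ->
  polynomial_function (fun x => f (rho delta x)).
Proof.
move=> pf; apply: (polynomial_comp pf); exact: polynomial_mapping_lfun.
Qed.

Lemma average_invariant f : invariants Gamma_plus rho f ->
  invariants Gamma rho (average f).
Proof.
move=> fG; split.
  apply: polynomialM; first exact: polynomial_cst.
  by apply: polynomialD; last apply: polynomial_comp_delta; exact: fG.1.
move=> a x Ga; rewrite /average; case: (eta_sign.1 _ Ga) => ea.
  by rewrite fG.2// (invariant_delta_even _ fG).
by rewrite (invariant_odd _ fG)// (invariant_delta_odd _ fG)// addrC.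
Qed.

Lemma reynolds_invariant f : invariants Gamma_plus rho f ->
  invariants Gamma_plus rho (S f).
Proof.
move=> fG; split.
  apply: polynomialM; first exact: polynomial_cst.
  by apply: polynomialB; last apply: polynomial_comp_delta; exact: fG.1.
by move=> a x Ga; rewrite /S /reynolds fG.2// (invariant_delta_even _ fG).
Qed.

Lemma invariantsD G (f g : V -> R) : invariants G rho f -> invariants G rho g ->
  invariants G rho (fun x => f x + g x).
Proof.
by move=> [pf fG] [pg gG]; split=> [|a x Ga]; [exact: polynomialD | rewrite fG// gG].
Qed.

Lemma invariantsM G (f g : V -> R) : invariants G rho f -> invariants G rho g ->
  invariants G rho (fun x => f x * g x).
Proof.
by move=> [pf fG] [pg gG]; split=> [|a x Ga]; [exact: polynomialM | rewrite fG// gG].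
Qed.

Lemma invariants_cst G (c : R) : invariants G rho (fun=> c).
Proof. by split=> //; exact: polynomial_cst. Qed.

(** Expand [f = average f + S f] and [g = average g + S g] in the product; the
    terms that change sign under [delta] are those with a single factor [S]. *)
Lemma reynoldsM f g x :
  S (fun y => f y * g y) x = average f x * S g x + average g x * S f x.
Proof.
rewrite /S /reynolds /average.
move: (f x) (g x) (f _) (g _) => a b c d.
by field.
Qed.

Lemma reynoldsD f g x : S (fun y => f y + g y) x = S f x + S g x.
Proof. by rewrite /S /reynolds -mulrDr opprD addrACA. Qed.

Section Generators.
Context {s : nat} (u : 'I_s -> V -> R).
Hypothesis u_basis : hilbert_basis (invariants Gamma_plus rho) u.

Let reynolds_in_span f := exists c : 'I_s -> V -> R,
  (forall i, invariants Gamma rho (c i)) /\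
  forall x, S f x = \sum_i c i x * S (u i) x.

Lemma reynolds_span f : invariants Gamma_plus rho f -> reynolds_in_span f.
Proof.
move=> /u_basis.2[p fp].
rewrite (_ : f = fun x => mpoly.meval (fun i => u i x) p); last exact/funext.
(* The product rule involves averages, which are invariant only for kernel
   invariants; hence the conjunction. *)
pose P f := invariants Gamma_plus rho f /\ reynolds_in_span f.
suff [] : P (fun x => mpoly.meval (fun i => u i x) p) by [].
apply: meval_closed => [c|f1 f2 [f1G [c1 [c1G c1E]]] [f2G [c2 [c2G c2E]]]
  |f1 f2 [f1G [c1 [c1G c1E]]] [f2G [c2 [c2G c2E]]]|k].
- split; first exact: invariants_cst.
  exists (fun _ _ => 0); split=> [i|x]; first exact: invariants_cst.
  rewrite /S /reynolds subrr mulr0 big1// => i _; exact: mul0r.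
- split; first exact: invariantsD.
  exists (fun i x => c1 i x + c2 i x); split=> [i|x]; first exact: invariantsD.
  rewrite reynoldsD c1E c2E -big_split.
  by apply: eq_bigr => i _; rewrite mulrDl.
- split; first exact: invariantsM.
  exists (fun i x => average f1 x * c2 i x + average f2 x * c1 i x).
  split=> [i|x].
    by apply: invariantsD; apply: invariantsM => //; exact: average_invariant.
  rewrite reynoldsM c1E c2E !mulr_sumr -big_split.
  by apply: eq_bigr => i _; rewrite mulrDl !mulrA.
- split; first exact: u_basis.1.
  exists (fun i _ => (i == k)%:R); split=> [i|x]; first exact: invariants_cst.
  rewrite (bigD1 k)//= eqxx mul1r big1 ?addr0// => i /negPf ->.
  exact: mul0r.
Qed.

(** The term of index 0, where [utilde] is 1, carries [average f]. *)
Lemma invariants_span f : invariants Gamma_plus rho f ->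
  exists c : 'I_s.+1 -> V -> R, (forall i, invariants Gamma rho (c i)) /\
    forall x, f x = \sum_i c i x * utilde rho delta u i x.
Proof.
move=> fG; have [c [cG cE]] := reynolds_span fG.
exists (fun i => if unlift ord0 i is Some k then c k else average f).
split=> [i|x]; first by case: unliftP => [k|] _ //; exact: average_invariant.
rewrite average_reynolds cE big_ord_recl /utilde unlift_none mulr1.
by congr (_ + _); apply: eq_bigr => i _; rewrite liftK.
Qed.

Lemma utilde_invariant i : invariants Gamma_plus rho (utilde rho delta u i).
Proof.
rewrite /utilde; case: unliftP => [k|] _; last exact: invariants_cst.
by apply: reynolds_invariant; exact: u_basis.1.
Qed.

End Generators.

(** * The vector Reynolds operator *)

Let twist (g : V -> W) : V -> W := fun x => (nu delta)^-1%VF (g (rho delta x)).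

(** On kernel equivariants, an element outside the kernel exchanges [g] and
    its twist by [delta], up to its own action on the target; so it negates
    their difference. *)
Lemma equivariant_odd g a x : equivariants Gamma_plus rho nu g ->
  Gamma a -> eta a = -1 -> g (rho a x) = nu a (twist g x).
Proof.
move=> [_ gG] Ga /(odd_coset Ga)[b Gb ->]; have [Gb' _] := Gb.
by rewrite rhoM// gG// nuM// /twist lker0_lfunVK.
Qed.

Lemma twist_odd g a x : equivariants Gamma_plus rho nu g ->
  Gamma a -> eta a = -1 -> twist g (rho a x) = nu a (g x).
Proof.
move=> [_ gG] Ga ea; rewrite /twist -rhoM// gG; last exact: odd_mul_delta.
by rewrite nuM// lker0_lfunK.
Qed.

Lemma twist_even g a x : equivariants Gamma_plus rho nu g ->
  Gamma_plus a -> twist g (rho a x) = nu a (twist g x).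
Proof.
move=> gG Gpa; have [Ga _] := Gpa; have [Gda eda] := delta_mul_even Gpa.
by rewrite {1}/twist -rhoM// (equivariant_odd _ gG)// nuM// lker0_lfunK.
Qed.

Lemma vreynolds_eta_equivariant g : equivariants Gamma_plus rho nu g ->
  eta_equivariants Gamma rho nu eta (vreynolds rho nu delta g).
Proof.
move=> gG; split.
  apply: (polynomial_mappingZ (f := fun=> 2^-1)); first exact: polynomial_cst.
  apply: polynomial_mappingB; first exact: gG.1.
  apply: (polynomial_mapping_comp (polynomial_mapping_lfun _)).
  apply: (polynomial_mapping_comp gG.1); exact: polynomial_mapping_lfun.
move=> a x Ga; rewrite /vreynolds -!/(twist g _).
case: (eta_sign.1 _ Ga) => ea; rewrite ea.
  by rewrite scale1r gG.2// (twist_even _ gG)// -linearB linearZ.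
rewrite (equivariant_odd _ gG)// (twist_odd _ gG)//.
rewrite mulrN1z scaleN1r linearZ -scalerN /=.
by congr (_ *: _); rewrite linearB opprB.
Qed.

Lemma eta_equivariants_sub g : eta_equivariants Gamma rho nu eta g ->
  equivariants Gamma_plus rho nu g.
Proof.
by move=> [pg gG]; split=> // a x [Ga ea]; rewrite gG// ea scale1r.
Qed.

Lemma vreynolds_id g x : eta_equivariants Gamma rho nu eta g ->
  vreynolds rho nu delta g x = g x.
Proof.
move=> [_ gG]; rewrite /vreynolds gG// eta_delta mulrN1z scaleN1r linearN.
rewrite /= opprK lker0_lfunK// -mulr2n -[g x *+ 2]scaler_nat.
by rewrite scalerA mulVf ?scale1r// pnatr_eq0.
Qed.

Lemma vreynolds_sum (I : finType) (c : I -> V -> R) (K : I -> V -> W) x :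
  (forall i, invariants Gamma rho (c i)) ->
  vreynolds rho nu delta (fun y => \sum_i c i y *: K i y) x =
  \sum_i c i x *: vreynolds rho nu delta (K i) x.
Proof.
move=> cG; rewrite /vreynolds linear_sum -sumrB scaler_sumr.
apply: eq_bigr => i _; rewrite (cG i).2// linearZ -scalerBr !scalerA.
by rewrite mulrC.
Qed.

End Reynolds.

Theorem mainTheorem2 (R : realType) (n : nat) (Gamma : set 'M[R]_n)
    (V W : vectType R)
    (rho : 'M[R]_n -> 'End(V)) (nu : 'M[R]_n -> 'End(W))
    (eta : 'M[R]_n -> int)
    (s r : nat) (u : 'I_s -> V -> R) (H : 'I_r.+1 -> V -> W)
    (delta : 'M[R]_n) :
  closed_subgroup_of_O Gamma ->
  \dim {:V} = n ->
  representation Gamma rho ->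
  representation Gamma nu ->
  sign_homomorphism Gamma eta ->
  (exists a, Gamma a /\ eta a <> 1) ->
  let Gamma_plus := sign_kernel Gamma eta in
  hilbert_basis (invariants Gamma_plus rho) u ->
  generates_module (invariants Gamma_plus rho)
    (equivariants Gamma_plus rho nu) H ->
  (Gamma `\` Gamma_plus) delta ->
  generates_module (invariants Gamma rho)
    (eta_equivariants Gamma rho nu eta) (Htilde rho nu delta u H).
Proof.
move=> GammaG _ rhoG nuG etaG _ Gp uB [HM Hspan] dG; split=> [[i j]|g gG].
  apply: (vreynolds_eta_equivariant GammaG) => //.
  have [pu uG] := utilde_invariant GammaG rhoG etaG dG uB i.
  have [pH HG] := HM j; split=> [|a x Ga]; first exact: polynomial_mappingZ.
  by rewrite uG// HG// linearZ.
have [p [pG gE]] := Hspan _ (eta_equivariants_sub gG).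
have /boolp.choice[c cP] j := invariants_span GammaG rhoG etaG dG uB (pG j).
exists (fun ij => c ij.2 ij.1); split=> [[i j]|x]; first exact: (cP j).1.
pose K (ij : 'I_s.+1 * 'I_r.+1) y := utilde rho delta u ij.1 y *: H ij.2 y.
rewrite -(vreynolds_id GammaG nuG etaG dG x gG).
apply: etrans (vreynolds_sum dG (c := fun ij => c ij.2 ij.1) K x _); last first.
  by move=> [i j]; exact: (cP j).1.
congr (vreynolds _ _ _ _ _); apply/funext => y; rewrite gE.
rewrite -(pair_bigA _ (fun i j => c j i y *: K (i, j) y)) exchange_big.
apply: eq_bigr => j _; rewrite (cP j).2 scaler_suml.
by apply: eq_bigr => i _; rewrite scalerA.
Qed.
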